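(* Let $m\in\mathbb R$ satisfy $D^-M(m)\le 0\le D^+M(m)$ (i.e. $m$ is a minimizer of $M$), and assume the boundedness condition (B) holds. Then for every $n\in\mathbb N$: \begin{align*} &\mathbb P\Big(\sup_{k\ge n}(\hat m_k-m)>x\Big)\le \exp\{-2(b(x)-a(x))^{-2}\,n\,D^+M(m+x)^2\}\quad\forall x>0,\\ &\mathbb P\Big(\inf_{k\ge n}(\hat m_k-m)<-x\Big)\le \exp\{-2(b(-x)-a(-x))^{-2}\,n\,D^+M(m-x)^2\}\quad\forall x>0,\\ &\mathbb P\Big(\sup_{k\ge n}|\hat m_k-m|>x\Big)\le 2\exp\{-2A(x)^{-2}\,n\,d(x)^2\}\quad\forall x>0, \end{align*} where $A(x):=\max\{b(x)-a(x),\,b(-x)-a(-x)\}$ and $d(x):=\min\{D^+M(m+x),\,-D^+M(m-x)\}\ge 0$. Moreover, if $m$ is the unique minimizing point of $M$, then $d(x)>0$ for every $x>0$ (and also $D^+M(m+x)>0$ and $-D^+M(m-x)>0$ for all $x>0$), so that each of the three bounds decays exponentially fast in $n$.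
   Context: Let $(S,\mathcal S,Q)$ be a probability space and $h:S\times\mathbb R\to\mathbb R$ such that $h(\cdot,t)$ is $\mathcal S$-measurable for every $t\in\mathbb R$ and $h(x,\cdot)$ is convex for every $x\in S$. For $f:\mathbb R\to\mathbb R$ convex, $D^+f$ and $D^-f$ denote its right and left derivatives; $D^\pm h(x,t)$ denotes the one-sided derivatives of $h(x,\cdot)$ at $t$. Assume $\int_S|D^+h(x,t)|\,Q(dx)<\infty$ and $\int_S|D^-h(x,t)|\,Q(dx)<\infty$ for all $t\in\mathbb R$. Fix $t_0\in\mathbb R$ and set $M(t):=\int_S (h(x,t)-h(x,t_0))\,Q(dx)$; $M$ is real-valued and convex with $D^\pm M(t)=\int_S D^\pm h(x,t)\,Q(dx)$. Let $X_1,X_2,\dots$ be i.i.d. $S$-valued random variables on a probability space $(\Omega,\mathcal A,\mathbb P)$ with common law $Q$, let $M_n(t):=\frac1n\sum_{i=1}^n (h(X_i,t)-h(X_i,t_0))$, and let $\hat m_n$ be the smallest minimizing point of $M_n$ (assumed to exist; it is a random variable). Boundedness condition (B): for every $x\neq 0$ there are reals $a(x)<b(x)$ with $a(x)\le D^+h(X_1,m+x)\le b(x)$ almost surely. *)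

(* Defs.v *)
From HB Require Import structures.
From mathcomp Require Import all_boot all_order all_algebra.
From mathcomp Require Import all_classical all_reals all_analysis.
Set Implicit Arguments. Unset Strict Implicit. Unset Printing Implicit Defensive.
Import Order.TTheory GRing.Theory Num.Theory.
Import numFieldNormedType.Exports.
Local Open Scope classical_set_scope.
Local Open Scope ring_scope.

Definition convex_fun {R : realType} (f : R -> R) : Prop :=
  forall (x y l : R), 0 <= l -> l <= 1 ->
    f (l * x + (1 - l) * y) <= l * f x + (1 - l) * f y.

Definition Dplus {R : realType} (f : R -> R) (t : R) : R :=
  lim ((fun e : R => (f (t + e) - f t) / e) @ 0^'+).

Definition Dminus {R : realType} (f : R -> R) (t : R) : R :=
  lim ((fun e : R => (f t - f (t - e)) / e) @ 0^'+).

Definition mutually_independent {R : realType} {dO dS}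
  {Omega : measurableType dO} {S : measurableType dS}
  (P : probability Omega R) (X : nat -> Omega -> S) : Prop :=
  forall (I : seq nat) (A : nat -> set S), uniq I ->
    (forall i, i \in I -> measurable (A i)) ->
    P (\bigcap_(i in [set` I]) (X i @^-1` A i)) =
      (\prod_(i <- I) P (X i @^-1` A i))%E.

Definition Mpop {R : realType} {dS} {S : measurableType dS}
  (Q : probability S R) (h : S -> R -> R) (t0 t : R) : R :=
  fine (\int[Q]_x ((h x t - h x t0)%:E)).

(** Empirical criterion  M_n(t) = (1/n) sum_{i=1}^n (h(X_i,t) - h(X_i,t0)),
    with the sample X_1, ..., X_n written X 0, ..., X (n-1). *)
Definition Memp {R : realType} {dS} {S : measurableType dS} {Omega : Type}
  (h : S -> R -> R) (t0 : R) (X : nat -> Omega -> S) (n : nat)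
  (w : Omega) (t : R) : R :=
  n%:R^-1 * \sum_(i < n) (h (X i w) t - h (X i w) t0).

(* Main.v *)
(** The right derivative [Dplus f t] is a subgradient at [t] of a convex [f].
    Hence [\sum_(i < k) Dplus (h X_i) t] is negative when the smallest minimizer
    of the empirical criterion [M_k] exceeds [t], and nonnegative when it is
    smaller than [t]. By dominated convergence a summand has mean [Dplus M t],
    so, up to a sign, each tail event makes a random walk [W] with bounded steps
    of mean [mu <= 0] nonnegative at some time [k >= n]. By Hoeffding's lemma a
    suitable [l >= 0] gives the step [Y] the bound [E[expR (l * Y)] <= r], where
    [r = expR (- 2 * mu ^+ 2 / (b - a) ^+ 2) <= 1]. So [expR (l * W k)] is a
    supermartingale, its mean at time [n] is at most [r ^+ n], and the maximal
    inequality from time [n] on bounds the probability that it ever reaches 1. *)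
Require Import Defs.
From HB Require Import structures.
From mathcomp Require Import all_boot all_order all_algebra.
From mathcomp Require Import all_classical all_reals all_analysis.
From mathcomp Require Import measurable_realfun ring lra.
Import Order.TTheory GRing.Theory Num.Theory.
Import numFieldNormedType.Exports.
Local Open Scope classical_set_scope.
Local Open Scope ring_scope.

(** * One-sided derivatives and subgradients of convex functions *)

Lemma convex_fun_slope (R : realType) (f : R -> R) (x y z : R) :
  convex_fun f -> x < y -> y < z ->
  (f y - f x) / (y - x) <= (f z - f x) / (z - x) /\
  (f y - f x) / (y - x) <= (f z - f y) / (z - y).
Proof.
move=> cf xy yz.
have zx : 0 < z - x by lra.
pose l := (z - y) / (z - x).
have l0 : 0 <= l by rewrite divr_ge0 //; lra.
have l1 : l <= 1 by rewrite ler_pdivrMr //; lra.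
have := cf x z l l0 l1.
have -> : l * x + (1 - l) * z = y by rewrite /l; field; lra.
move=> fy.
have {}fy : f y * (z - x) <= (z - y) * f x + (y - x) * f z.
  have -> : (z - y) * f x + (y - x) * f z =
      (l * f x + (1 - l) * f z) * (z - x) by rewrite /l; field; lra.
  by rewrite ler_pM2r.
by split; rewrite ler_pdivrMr ?subr_gt0 // mulrAC ler_pdivlMr ?subr_gt0 //; nra.
Qed.

(** The quotient is nondecreasing in [e] and bounded below by the slope of the chord from [t - 1] to
    [t], so it converges from the right. This makes the [lim] in [Dplus] a genuine limit. *)
Lemma Dplus_slopeE (R : realType) (f : R -> R) (t : R) : convex_fun f ->
  (f (t + e) - f t) / e @[e --> 0^'+] -->
    inf [set (f (t + e) - f t) / e | e in [set` `]0, +oo[]].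
Proof.
move=> cf.
apply: (@nondecreasing_at_right_cvgr _ (fun e => (f (t + e) - f t) / e) 0 +oo%O).
- by [].
- move=> x y; rewrite !in_itv/= !andbT => x0 y0.
  rewrite le_eqVlt => /predU1P[->//|xy].
  have [|||+ _] := @convex_fun_slope _ f t (t + x) (t + y) => //; try lra.
  by rewrite !(addrC t) !addrK.
- exists (f t - f (t - 1)) => _ [e + <-]; rewrite /= in_itv/= andbT => e0.
  have [|||_] := @convex_fun_slope _ f (t - 1) t (t + e) => //; try lra.
  rewrite [t + e - t]addrAC subrr add0r (_ : t - (t - 1) = 1) ?divr1 //.
  by ring.
Qed.

Lemma Dplus_cvg (R : realType) (f : R -> R) (t : R) : convex_fun f ->
  (f (t + e) - f t) / e @[e --> 0^'+] --> Dplus f t.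
Proof.
by move=> cf; rewrite /Dplus (cvg_lim _ (Dplus_slopeE _ _ t cf)) //; exact: Dplus_slopeE.
Qed.

(** Measurability of limits and dominated convergence both call for a sequence of quotients. *)
Lemma Dplus_harmonic_cvg (R : realType) (f : R -> R) (t : R) : convex_fun f ->
  (f (t + harmonic n) - f t) / harmonic n @[n --> \oo] --> Dplus f t.
Proof.
move=> cf; have /cvg_at_rightP := Dplus_cvg _ _ t cf; apply; split.
  by move=> n; rewrite harmonic_gt0.
exact: cvg_harmonic.
Qed.

(** Chord slopes increase: a chord ending at [t] is no steeper than the quotients defining
    [Dplus f t], and a chord from [t] up to [s] bounds them from above once [e < s - t]. *)
Lemma Dplus_subgradient (R : realType) (f : R -> R) (t s : R) : convex_fun f ->
  f t + Dplus f t * (s - t) <= f s.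
Proof.
move=> cf; have [st|ts|->] := ltgtP s t; last by rewrite subrr mulr0 addr0.
- suff : (f t - f s) / (t - s) <= Dplus f t.
    by rewrite ler_pdivrMr ?subr_gt0 //; nra.
  apply: (cvgr_to_ge (Dplus_cvg _ _ t cf)); near=> e.
  have e0 : 0 < e by near: e; exact: nbhs_right_gt.
  have [|||_] := @convex_fun_slope _ f s t (t + e) => //; try lra.
  by rewrite [t + e - t]addrAC subrr add0r.
- suff : Dplus f t <= (f s - f t) / (s - t).
    by rewrite ler_pdivlMr ?subr_gt0 //; nra.
  apply: (cvgr_to_le (Dplus_cvg _ _ t cf)); near=> e.
  have e0 : 0 < e by near: e; exact: nbhs_right_gt.
  have es : e < s - t by near: e; apply: nbhs_right_lt; rewrite subr_gt0.
  have [|||+ _] := @convex_fun_slope _ f t (t + e) s => //; try lra.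
  by rewrite [t + e - t]addrAC subrr add0r.
Unshelve. all: by end_near. Qed.

Lemma convex_fun_opp (R : realType) (f : R -> R) :
  convex_fun f -> convex_fun (fun u => f (- u)).
Proof.
move=> cf x y l l0 l1.
by rewrite (_ : - (l * x + (1 - l) * y) = l * - x + (1 - l) * - y); [exact: cf|ring].
Qed.

(** Reflection exchanges the two one-sided derivatives, so facts about [Dplus] carry over to
    [Dminus]. *)
Lemma DminusE (R : realType) (f : R -> R) (t : R) : convex_fun f ->
  Dminus f t = - Dplus (fun u => f (- u)) (- t).
Proof.
move=> cf.
have cg := convex_fun_opp _ _ cf.
apply: cvg_lim => //.
rewrite (_ : (fun e => _) = (fun e => - ((f (- (- t + e)) - f (- - t)) / e))).
  by apply: cvgN; exact: (Dplus_cvg _ _ (- t) cg).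
by apply/funext => e; rewrite opprD !opprK -mulNr opprB.
Qed.

Lemma Dminus_subgradient (R : realType) (f : R -> R) (t s : R) : convex_fun f ->
  f t + Dminus f t * (s - t) <= f s.
Proof.
move=> cf; rewrite DminusE //.
have cg := convex_fun_opp _ _ cf.
have := Dplus_subgradient _ _ (- t) (- s) cg; rewrite /= !opprK.
by apply: le_trans; rewrite le_eqVlt; apply/orP; left; apply/eqP; ring.
Qed.

(** * Hoeffding's lemma *)

Lemma is_derive_ge0_ndecr (R : realType) (f df : R -> R) (u : R) :
  (forall x : R, is_derive x 1 f (df x)) ->
  (forall x, 0 < x -> 0 <= df x) -> 0 <= u -> f 0 <= f u.
Proof.
move=> fE df0 u0.
have fder x : derivable f x 1 by have [] := fE x.
apply: (@ger0_derive1_ndecry _ f 0) => //.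
- by move=> x; rewrite in_itv/= andbT derive1E derive_val; exact: df0.
- by apply: derivable_within_continuous.
Qed.

(** The left side is the moment generating function [D] of a Bernoulli variable. The gap [g] between
    the exponent and [ln D] vanishes at 0, and so does its derivative [k]. With
    [q = p * expR v / D v], the derivative of [k] is [1/4 - q * (1 - q)], which is nonnegative. *)
Lemma bernoulli_mgf_le (R : realType) (p u : R) : 0 <= p <= 1 -> 0 <= u ->
  1 - p + p * expR u <= expR (p * u + u ^+ 2 / 8).
Proof.
move=> /andP[p0 p1] u0.
pose D (v : R) : R := 1 - p + p * expR v.
have D0 v : 0 < D v.
  rewrite /D; have := expR_gt0 v; have [->|pn0] := eqVneq p 0; first by nra.
  have p_gt0 : 0 < p by rewrite lt0r pn0.
  by nra.
have dD (v : R) : is_derive v 1 D (p * expR v).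
  rewrite /D; apply: is_derive_eq.
  by rewrite /GRing.scale/=; ring.
pose k (v : R) : R := v / 4 + p - p * expR v / D v.
have k0 v : 0 <= v -> 0 <= k v.
  move=> v0.
  have -> : 0 = k 0 :> R by rewrite /k /D expR0 mulr1 subrK mul0r add0r divr1 subrr.
  apply: (@is_derive_ge0_ndecr R k
    (fun v => 4^-1 - p * expR v * (1 - p) / D v ^+ 2) v _ _ v0).
  - move=> x.
    have dV := @is_deriveV _ D x _ 1 (lt0r_neq0 (D0 x)) (dD x).
    rewrite /k; apply: is_derive_eq.
    rewrite /GRing.scale/= /D; field; exact: lt0r_neq0 (D0 x).
  - move=> x _; rewrite subr_ge0 ler_pdivrMr ?exprn_gt0 // /D.
    rewrite -subr_ge0 (_ : _ - _ = (1 - p - p * expR x) ^+ 2 / 4); last by field.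
    by rewrite divr_ge0 // sqr_ge0.
pose g (v : R) : R := p * v + v ^+ 2 / 8 - ln (D v).
have : g 0 <= g u.
  apply: (@is_derive_ge0_ndecr R g k u _ _ u0); last by move=> x /ltW; exact: k0.
  move=> x.
  have dl := is_derive1_ln (D0 x).
  rewrite /g; apply: is_derive_eq.
  rewrite /k /GRing.scale/= /D; field; exact: lt0r_neq0 (D0 x).
rewrite /g {1}/D expR0 mulr0 expr0n mul0r mulr1 subrK ln1 subr0 addr0 subr_ge0.
by rewrite -ler_expR lnK // posrE.
Qed.

(** The tangent at [y] lies below the exponential at [a] and at [b]; with the weights [b - y] and
    [y - a] the linear terms cancel. *)
Lemma expR_chord (R : realType) (l a b y : R) : a <= y <= b ->
  (b - a) * expR (l * y) <= (b - y) * expR (l * a) + (y - a) * expR (l * b).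
Proof.
move=> /andP[ay yb].
have tangent z : expR (l * y) * (1 + l * (z - y)) <= expR (l * z).
  have -> : l * z = l * y + l * (z - y) by ring.
  by rewrite expRD ler_pM2l ?expR_gt0 // expR_ge1Dx.
rewrite (_ : (b - a) * _ = (b - y) * (expR (l * y) * (1 + l * (a - y))) +
  (y - a) * (expR (l * y) * (1 + l * (b - y)))); last by ring.
by rewrite lerD // ler_wpM2l // subr_ge0.
Qed.

(** Bounding the exponential by its chord replaces [Y] by a variable with values [a] and [b] and the
    same mean, an affine image of a Bernoulli variable. *)
Lemma hoeffding_mgf_le d (T : measurableType d) (R : realType)
    (P : probability T R) (Y : T -> R) (a b l : R) :
  measurable_fun setT Y -> a < b -> 0 <= l ->
  {ae P, forall w, a <= Y w <= b} ->
  (\int[P]_w (expR (l * Y w))%:E <=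
   (expR (l * fine (\int[P]_w (Y w)%:E) + l ^+ 2 * (b - a) ^+ 2 / 8))%:E)%E.
Proof.
move=> mY ab l0 Yab.
(* Clamping [Y] to [[a, b]] changes it on a null set only and makes the bounds hold everywhere. *)
pose Z w := Num.max a (Num.min b (Y w)).
have mZ : measurable_fun setT Z.
  by apply: measurable_maxr => //; exact: measurable_minr.
have Zab w : a <= Z w <= b.
  by rewrite /Z le_max lexx ge_max ge_min lexx (ltW ab).
have YZ : {ae P, forall w, setT w -> Y w = Z w}.
  apply: filterS Yab => w /andP[aY Yb] _.
  by rewrite /Z (min_idPr Yb) (max_idPr aY).
have iZ : P.-integrable setT (EFin \o Z).
  apply: measurable_bounded_integrable => //.
    by rewrite (le_lt_trans (probability_le1 _ _)) ?ltry.
  exists (`|a| + `|b|); split; first by rewrite num_real.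
  move=> M M0 w _ /=; rewrite (le_trans _ (ltW M0)) //.
  have /andP[] := Zab w; rewrite ler_norml.
  have := ler_norm a; have := ler_norm b; have := ler_norm (- a).
  have := ler_norm (- b); rewrite !normrN; lra.
rewrite (ae_eq_integral (fun w => (expR (l * Z w))%:E)) //; first last.
- by apply: filterS YZ => w /[apply] ->.
- apply/measurable_EFinP/measurableT_comp => //; exact: measurable_funM.
- apply/measurable_EFinP/measurableT_comp => //; exact: measurable_funM.
rewrite [X in fine X](ae_eq_integral (EFin \o Z)) //; first last.
- by apply: filterS YZ => w /[apply] ->.
- exact/measurable_EFinP.
- exact/measurable_EFinP.
set mu := fine _.
have muE : (\int[P]_w (Z w)%:E = mu%:E)%E.
  by rewrite /mu fineK //; exact: integrable_fin_num.
(* The line [al + be * z] is the chord of [expR (l * z)] between [a] and [b]. *)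
pose al := (b * expR (l * a) - a * expR (l * b)) / (b - a).
pose be := (expR (l * b) - expR (l * a)) / (b - a).
have ba0 : 0 < b - a by rewrite subr_gt0.
have P1 : (P : {measure set T -> \bar R}) setT = 1%E by exact: probability_setT.
have ic r : P.-integrable setT (EFin \o cst r).
  exact: finite_measure_integrable_cst.
have muab : a <= mu <= b.
  rewrite -!lee_fin -muE; apply/andP; split.
  - apply: (@le_trans _ _ (\int[P]_w (cst a w)%:E)%E).
      by rewrite (integral_cst _ _ a%:E) // P1 mule1.
    apply: le_integral => //; [exact: ic|move=> w _].
    by rewrite lee_fin; have /andP[] := Zab w.
  - apply: (@le_trans _ _ (\int[P]_w (cst b w)%:E)%E).
      apply: le_integral => //; [exact: ic|move=> w _].
      by rewrite lee_fin; have /andP[] := Zab w.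
    by rewrite (integral_cst _ _ b%:E) // P1 mule1.
apply: (@le_trans _ _ (\int[P]_w (al + be * Z w)%:E)%E).
  apply: ge0_le_integral => //.
  - apply/measurable_EFinP/measurableT_comp => //; exact: measurable_funM.
  - apply/measurable_EFinP; apply: measurable_funD => //.
    exact: measurable_funM.
  - move=> w _; rewrite lee_fin.
    rewrite (_ : al + _ = ((b - Z w) * expR (l * a) + (Z w - a) * expR (l * b))
      / (b - a)); last by rewrite /al /be; field; lra.
    by rewrite ler_pdivlMr // mulrC; exact: expR_chord.
under eq_integral do rewrite EFinD EFinM.
rewrite integralD //=; [|exact: ic|exact: (integrableZl measurableT be iZ)].
rewrite (integral_cst _ _ al%:E) // P1 mule1.
have -> : (\int[P]_w (be%:E * (Z w)%:E) = be%:E * mu%:E)%E.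
  by rewrite -muE; exact: (integralZl measurableT iZ be).
rewrite -EFinM -EFinD lee_fin.
pose p := (mu - a) / (b - a).
have p01 : 0 <= p <= 1.
  have /andP[amu mub] := muab.
  by rewrite divr_ge0 ?subr_ge0 ?(ltW ab) //= ler_pdivrMr // mul1r lerD2r.
have := @bernoulli_mgf_le R p (l * (b - a)) p01 (mulr_ge0 l0 (ltW ba0)).
(* The factor [expR (l * a)] undoes the shift of [[a, b]] to [[0, b - a]]. *)
rewrite -(@ler_pM2l _ (expR (l * a))) ?expR_gt0 // -expRD.
rewrite mulrDr mulrCA -expRD.
have -> : l * a + l * (b - a) = l * b by ring.
have -> : l * a + (p * (l * (b - a)) + (l * (b - a)) ^+ 2 / 8) =
    l * mu + l ^+ 2 * (b - a) ^+ 2 / 8 by rewrite /p; field; lra.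
apply: le_trans; rewrite le_eqVlt; apply/orP; left; apply/eqP.
by rewrite /al /be /p; field; lra.
Qed.

(** * Independence of the past and the next observation *)

(** The joint law of [V] and [W] agrees with the product of their laws on rectangles, hence
    everywhere, and Tonelli's theorem factors the integral. *)
Lemma independent_integralM d d1 d2 (T : measurableType d)
    (T1 : measurableType d1) (T2 : measurableType d2) (R : realType)
    (P : probability T R) (V : T -> T1) (W : T -> T2)
    (U : T1 -> \bar R) (f : T2 -> \bar R) :
  measurable_fun setT V -> measurable_fun setT W ->
  measurable_fun setT U -> measurable_fun setT f ->
  (forall x, 0 <= U x)%E -> (forall y, 0 <= f y)%E ->
  (forall A B, measurable A -> measurable B ->
    P (V @^-1` A `&` W @^-1` B) = P (V @^-1` A) * P (W @^-1` B))%E ->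
  (\int[P]_w (U (V w) * f (W w)) =
   (\int[P]_w U (V w)) * \int[P]_w f (W w))%E.
Proof.
move=> mV mW mU mf U0 f0 PVW.
pose V' : {mfun T >-> T1} := HB.pack V (isMeasurableFun.Build _ _ _ _ V mV).
pose W' : {mfun T >-> T2} := HB.pack W (isMeasurableFun.Build _ _ _ _ W mW).
have mVW : measurable_fun setT (fun w => (V w, W w)).
  exact: measurable_fun_pair.
pose Z : {mfun T >-> (T1 * T2)%type} :=
  HB.pack (fun w => (V w, W w)) (isMeasurableFun.Build _ _ _ _ _ mVW).
pose m1 := distribution P V'.
pose m2 := distribution P W'.
pose F (z : T1 * T2) := (U z.1 * f z.2)%E.
have mF : measurable_fun setT F.
  by apply: emeasurable_funM; apply: measurableT_comp.
have F0 z : (0 <= F z)%E by rewrite /F mule_ge0.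
have -> : (\int[P]_w (U (V w) * f (W w)) = \int[(m1 \x m2)%E]_z F z)%E.
  transitivity (\int[distribution P Z]_z F z)%E.
    by rewrite ge0_integral_distribution.
  apply: eq_measure_integral => A mA _.
  by apply/esym; apply: product_measure_unique => // B C mB mC; exact: PVW.
rewrite fubini_tonelli1 // /fubini_F.
have -> : (\int[P]_w U (V w) = \int[m1]_x U x)%E.
  by rewrite /m1 ge0_integral_distribution.
have -> : (\int[P]_w f (W w) = \int[m2]_y f y)%E.
  by rewrite /m2 ge0_integral_distribution.
under eq_integral do rewrite /F/= ge0_integralZl //.
by rewrite ge0_integralZr // integral_ge0.
Qed.

(** A family closed under intersection that generates the sigma-algebra of the first [k]
    observations. The index list [iota 0 k] has the form that [mutually_independent] expects. *)
Definition cylinders d d' (Omega : measurableType d) (S : measurableType d')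
    (X : nat -> Omega -> S) (k : nat) : set (set Omega) :=
  [set E | exists2 A : nat -> set S, (forall i, measurable (A i)) &
     E = \bigcap_(i in [set` iota 0 k]) (X i @^-1` A i)].

Lemma cylinders_setI_closed d d' (Omega : measurableType d)
    (S : measurableType d') (X : nat -> Omega -> S) (k : nat) :
  setI_closed (cylinders _ _ _ _ X k).
Proof.
move=> _ _ [A mA ->] [B mB ->]; exists (fun i => A i `&` B i).
  by move=> i; exact: measurableI.
by rewrite -bigcapI.
Qed.

Lemma cylinders_measurable d d' (Omega : measurableType d)
    (S : measurableType d') (X : nat -> Omega -> S) (k : nat) :
  (forall i, measurable_fun setT (X i)) ->
  cylinders _ _ _ _ X k `<=` measurable.
Proof.
move=> mX _ [A mA ->]; apply: bigcap_measurableType => i _.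
by rewrite -[_ @^-1` _]setTI; exact: mX.
Qed.

(** As functions of [E] both sides are finite measures that agree on cylinders, so they agree on the
    generated sigma-algebra. *)
Lemma independent_cylinders d d' (R : realType) (Omega : measurableType d)
    (S : measurableType d') (P : probability Omega R) (X : nat -> Omega -> S)
    (k : nat) (E : set Omega) (B : set S) :
  (forall i, measurable_fun setT (X i)) -> mutually_independent P X ->
  <<s cylinders _ _ _ _ X k >> E -> measurable B ->
  (P (E `&` X k @^-1` B) = P E * P (X k @^-1` B))%E.
Proof.
move=> mX indX sE mB.
have mXB : measurable (X k @^-1` B) by rewrite -[_ @^-1` _]setTI; exact: mX.
have Pfin : P (X k @^-1` B) \is a fin_num by exact: fin_num_measure.
have c0 : 0 <= fine (P (X k @^-1` B)) by exact: fine_ge0.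
pose m2 := mscale (NngNum c0) P.
have m2E A : m2 A = (P A * P (X k @^-1` B))%E.
  by rewrite -[in RHS](fineK Pfin) muleC.
rewrite -m2E.
have -> : P (E `&` X k @^-1` B) = mrestr P mXB E by [].
apply: (g_sigma_algebra_measure_unique (cylinders _ _ _ _ X k)
  _ (fun=> setT)) => //.
- exact: cylinders_measurable.
- move=> _; exists (fun=> setT) => //.
  by apply/esym; rewrite -subTset => w _ i _.
- by rewrite bigcup_const.
- exact: cylinders_setI_closed.
- move=> _ [A mA ->]; rewrite [RHS]m2E /= /mrestr.
  (* Prescribing [B] at index [k] turns the intersection into a cylinder of length [k.+1], to which
     independence applies. *)
  pose A' i := if i == k then B else A i.
  have A'E i : i \in iota 0 k -> A' i = A i.
    by rewrite mem_iota /A' => /andP[_]; rewrite add0n ltn_neqAle => /andP[/negPf->].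
  have iotaS : iota 0 k.+1 = rcons (iota 0 k) k by rewrite -addn1 iotaD cats1.
  have -> : \bigcap_(i in [set` iota 0 k]) (X i @^-1` A i) `&` X k @^-1` B =
      \bigcap_(i in [set` iota 0 k.+1]) (X i @^-1` A' i).
    rewrite iotaS; apply/seteqP; split => w.
      move=> [Aw Bw] i /=; rewrite mem_rcons inE => /orP[/eqP->|ik].
        by rewrite /A' eqxx.
      by rewrite A'E //; exact: Aw.
    move=> Aw; split => [i/= ik|].
      by rewrite -A'E //; apply: Aw; rewrite /= mem_rcons inE ik orbT.
    have := Aw k; rewrite /A' eqxx; apply.
    by rewrite /= mem_rcons mem_head.
  rewrite indX ?iota_uniq //; last by move=> i _; rewrite /A'; case: ifP.
  rewrite indX ?iota_uniq // iotaS -cats1 big_cat/= big_seq1.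
  congr (_ * _)%E; last by rewrite /A' eqxx.
  by rewrite !big_seq; apply: eq_bigr => i /A'E ->.
- by move=> _; rewrite /= /mrestr setTI ltey_eq Pfin.
Qed.

(** * The maximal inequality for a random walk *)

Section random_walk.
Context {d d' : measure_display} {R : realType} {Omega : measurableType d}
  {S : measurableType d'} (P : probability Omega R) (X : nat -> Omega -> S)
  (g : S -> R).
Hypothesis mX : forall i, measurable_fun setT (X i).
Hypothesis indX : mutually_independent P X.
Hypothesis mg : measurable_fun setT g.

Let W k w := \sum_(i < k) g (X i w).
Let below n N := [set w | forall j, (n <= j < N)%N -> W j w < 0].
(** [Omega] with the sigma-algebra of the first [k] observations, so that being known at time [k] is
    measurability on this type. *)
Let past k := g_sigma_algebraType (cylinders _ _ _ _ X k).

Let past_coord k i : (i < k)%N ->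
  measurable_fun setT (X i : past k -> S).
Proof.
move=> ik _ B mB; rewrite setTI; apply: sub_sigma_algebra.
exists (fun j => if j == i then B else setT); first by move=> j; case: ifP.
apply/seteqP; split => [w Bw j _|w].
  by case: eqP => [->|].
by move/(_ i); rewrite eqxx; apply; rewrite /= mem_iota.
Qed.

Let past_walk k j : (j <= k)%N -> measurable_fun setT (W j : past k -> R).
Proof.
move=> jk; rewrite /W.
apply: (@measurable_sum _ (past k) R setT 'I_j _ (fun i w => g (X i w))) => i.
by apply: measurableT_comp => //; apply: past_coord; exact: leq_trans jk.
Qed.

Let past_sub k (E : set Omega) :
  measurable (E : set (past k)) -> measurable E.
Proof.
by apply: smallest_sub;
  [exact: sigma_algebra_measurable|exact: cylinders_measurable].
Qed.

(** The index is [k.+1] because [below n k.+1] constrains times up to [k] only, and [W k] involves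
    just the first [k] observations. *)
Let past_below n k : measurable (below n k.+1 : set (past k)).
Proof.
rewrite (_ : below n k.+1 = \bigcap_(j in [set j | (n <= j <= k)%N])
    (W j @^-1` `]-oo, 0[)); last first.
  by apply/seteqP; split => w Ww j /= /Ww; rewrite /= in_itv.
apply: (@bigcap_measurableType _ (past k)) => j /= /andP[_ jk].
by rewrite -[X in measurable X]setTI; exact: (past_walk k j jk).
Qed.

Variable (l : R) (r : R).
Hypothesis l0 : 0 <= l.
Hypothesis r1 : r <= 1.
Hypothesis mgf_le : forall i,
  (\int[P]_w (expR (l * g (X i w)))%:E <= r%:E)%E.

Let J k (E : set Omega) := (\int[P]_w (\1_E w * expR (l * W k w))%:E)%E.

Let past_integrand k (E : set Omega) : measurable (E : set (past k)) ->
  measurable_fun setT (fun w : past k => (\1_E w * expR (l * W k w))%:E).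
Proof.
move=> mE; apply/measurable_EFinP; apply: measurable_funM.
  exact: (@measurable_indic _ (past k)).
by apply: measurableT_comp => //; apply: measurable_funM => //; exact: past_walk.
Qed.

(** The supermartingale property: the new factor [expR (l * g (X k w))] is independent of everything
    known at time [k] and has mean at most [r]. *)
Let J_step k (E : set Omega) : measurable (E : set (past k)) ->
  (J k.+1 E <= J k E * r%:E)%E.
Proof.
move=> mE.
(* The identity map into [past k] serves as the random element that records the whole past. *)
have indE A B : measurable (A : set (past k)) -> measurable B ->
    P ((id : Omega -> past k) @^-1` A `&` X k @^-1` B) =
    (P ((id : Omega -> past k) @^-1` A) * P (X k @^-1` B))%E.
  by move=> mA mB; exact: independent_cylinders.
have mid : measurable_fun setT (id : Omega -> past k).
  by move=> _ A mA; rewrite setTI; exact: past_sub mA.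
have mexp : measurable_fun setT (fun x => (expR (l * g x))%:E).
  by apply/measurable_EFinP/measurableT_comp => //; exact: measurable_funM.
have ge0 (A : set Omega) w : (0 <= (\1_A w * expR (l * W k w))%:E)%E.
  by rewrite lee_fin mulr_ge0 ?expR_ge0.
have exp0 x : (0 <= (expR (l * g x))%:E)%E by rewrite lee_fin expR_ge0.
have -> : J k.+1 E = (\int[P]_w ((\1_E w * expR (l * W k w))%:E *
    (expR (l * g (X k w)))%:E))%E.
  apply: eq_integral => w _; rewrite -EFinM -mulrA -expRD -mulrDr.
  by rewrite /W big_ord_recr.
rewrite (@independent_integralM _ _ _ Omega (past k) S R P id (X k)
  (fun w => (\1_E w * expR (l * W k w))%:E) (fun x => (expR (l * g x))%:E)
  mid (mX k) (past_integrand k E mE)) //.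
by apply: lee_wpmul2l; [exact: integral_ge0|exact: mgf_le].
Qed.

Let J_setT k : (J k setT <= (r ^+ k)%:E)%E.
Proof.
elim: k => [|k IH].
  rewrite /J expr0 (eq_integral (cst 1%E)) => [|w _].
    by rewrite integral_cst // mul1e probability_le1.
  by rewrite indicE in_setT mul1r /W big_ord0 mulr0 expR0.
apply: (le_trans (J_step k setT _)).
  exact: (@measurableT _ (past k)).
rewrite exprSr EFinM; apply: lee_wpmul2r => //.
(* [r] is nonnegative because it bounds the integral of a positive function. *)
by apply: (le_trans _ (mgf_le 0)); apply: integral_ge0 => w _; rewrite lee_fin expR_ge0.
Qed.

(* [K n N] is at most the expectation at time [N] of the supermartingale
   [expR (l * W k)] stopped when the walk first becomes nonnegative at or after
   time [n]: the stopped value, which is at least 1, is replaced by 1. *)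
Let K n N := (P (~` below n N) + J N (below n N))%E.

Let measurable_below n N : (n <= N)%N -> measurable (below n N).
Proof.
case: N => [|N _]; last exact: past_sub (past_below n N).
rewrite leqn0 => /eqP ->; rewrite (_ : below _ _ = setT) //.
by rewrite -subTset => w _ j; rewrite ltn0 andbF.
Qed.

(** Going back from time [N.+1] to [N], the supermartingale step on [below n N.+1] costs nothing
    since [r <= 1]; the rest is a pointwise comparison at time [N]. *)
Let K_step n N : (n <= N)%N -> (K n N.+1 <= K n N)%E.
Proof.
move=> nN.
have mC := measurable_below n N nN.
have mC' := measurable_below n N.+1 (leqW nN).
have belowS w : below n N.+1 w <-> below n N w /\ W N w < 0.
  split=> [Ww|[Ww WN] j].
    split=> [j /andP[nj jN]|]; first by apply: Ww; rewrite nj leqW.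
    by apply: Ww; rewrite nN leqnn.
  rewrite ltnS (leq_eqVlt j) => /andP[nj /predU1P[->//|jN]].
  by apply: Ww; rewrite nj.
have mI (E : set Omega) : measurable E ->
    measurable_fun setT (fun w => (\1_E w * expR (l * W N w))%:E).
  move=> mE; apply/measurable_EFinP; apply: measurable_funM.
    exact: measurable_indic.
  apply: measurableT_comp => //; apply: measurable_funM => //.
  by apply: measurable_sum => i; exact: measurableT_comp.
have I0 (E : set Omega) w : (0 <= (\1_E w * expR (l * W N w))%:E)%E.
  by rewrite lee_fin mulr_ge0 ?expR_ge0.
apply: (@le_trans _ _ (P (~` below n N.+1) + J N (below n N.+1))%E).
  rewrite /K leeD2l // (le_trans (J_step _ _ (past_below n N))) //.
  by rewrite -[leRHS]mule1 lee_wpmul2l ?lee_fin //; exact: integral_ge0.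
have KE (E : set Omega) : measurable E -> (P (~` E) + J N E =
    \int[P]_w ((\1_(~` E) w)%:E + (\1_E w * expR (l * W N w))%:E))%E.
  move=> mE; have mE' := measurableC mE.
  rewrite ge0_integralD //.
  - by rewrite integral_indic // setIT.
  - exact/measurable_EFinP/measurable_indic.
  - exact: mI.
rewrite /K !KE //; apply: ge0_le_integral => //.
- by move=> w _; rewrite adde_ge0 ?lee_fin.
- apply: emeasurable_funD; last exact: mI.
  by apply/measurable_EFinP/measurable_indic/measurableC.
- apply: emeasurable_funD; last exact: mI.
  by apply/measurable_EFinP/measurable_indic/measurableC.
- move=> w _; rewrite -!EFinD lee_fin !indicE !in_setC.
  have [C'|nC'] := pselect (below n N.+1 w).
    have [C _] := (belowS w).1 C'.
    by rewrite !mem_set.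
  rewrite (memNset nC') /=.
  have [C|nC] := pselect (below n N w); last by rewrite memNset.
  (* Here the walk is nonnegative at time [N] for the first time from [n] on, so [expR (l * W N w)]
     is at least the 1 that replaces it. *)
  rewrite mem_set //= mul0r addr0 add0r mul1r -[leLHS]expR0 ler_expR.
  rewrite mulr_ge0 // leNgt; apply/negP => WN; apply: nC'.
  exact/belowS.
Qed.

Let K_le n M : (K n (n + M) <= (r ^+ n)%:E)%E.
Proof.
elim: M => [|M IH]; last first.
  by rewrite addnS (le_trans (K_step _ _ _)) // leq_addr.
rewrite addn0 /K (_ : below n n = setT).
  by rewrite setCT measure0 add0e J_setT.
rewrite -subTset => w _ j /andP[nj jn].
by have := leq_trans jn nj; rewrite ltnn.
Qed.

(** The complements of [below n (n + M)] increase to the event, and each has probability at most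
    [K n (n + M)]; continuity from below gives the bound. *)
Lemma maximal_walk_le (n : nat) :
  (P [set w | exists k, (n <= k)%N /\ (0 <= \sum_(i < k) g (X i w))%R] <=
   (r ^+ n)%:E)%E.
Proof.
rewrite (_ : [set w | _] = \bigcup_M (~` below n (n + M))); last first.
  apply/seteqP; split => [w /= [k [nk Wk]]|w [M _ /= /existsNP[j]]].
    exists (k - n).+1 => //= Ww; have := Ww k.
    by rewrite addnS subnKC // nk leqnn => /(_ isT); rewrite ltNge Wk.
  by move=> /not_implyP[/andP[nj _] /negP]; rewrite -leNgt => Wj; exists j.
have mb M : measurable (~` below n (n + M)).
  by apply: measurableC; apply: measurable_below; exact: leq_addr.
have nd : nondecreasing_seq (fun M => ~` below n (n + M)).
  move=> M1 M2 M12; apply/subsetPset/subsetC => w Ww j /andP[nj jM].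
  by apply: Ww; rewrite nj (leq_trans jM) // leq_add2l.
have cv := nondecreasing_cvg_mu (mu := P) mb (bigcup_measurable (fun M _ => mb M)) nd.
rewrite -(cvg_lim _ cv) //; apply: lime_le.
  by apply/cvg_ex; eexists; exact: cv.
apply: nearW => M /=; apply: le_trans (K_le n M).
by rewrite /K leeDl // integral_ge0 // => w _; rewrite lee_fin mulr_ge0 ?expR_ge0.
Qed.

End random_walk.

(** * The population criterion and differentiation under the integral *)

Section population.
Context {R : realType} {d : measure_display} {S : measurableType d}
  (Q : probability S R) (h : S -> R -> R).
Hypothesis mh : forall t, measurable_fun setT (fun x => h x t).
Hypothesis ch : forall x, convex_fun (h x).
Hypothesis fin_Dplus : forall t,
  (\int[Q]_x (`|Dplus (h x) t|)%:E < +oo)%E.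

Lemma measurable_Dplus t : measurable_fun setT (fun x => Dplus (h x) t).
Proof.
apply: (@measurable_fun_cvg _ _ _ setT
  (fun n x => (h x (t + harmonic n) - h x t) / harmonic n)).
- by move=> n; apply: measurable_funM => //; exact: measurable_funB.
- by move=> x _; exact: Dplus_harmonic_cvg.
Qed.

Lemma integrable_Dplus t : Q.-integrable setT (EFin \o (fun x => Dplus (h x) t)).
Proof.
apply/integrableP; split; last exact: fin_Dplus.
exact/measurable_EFinP/measurable_Dplus.
Qed.

(** The subgradient inequalities at [t] and at [s] enclose the increment between multiples of two
    integrable derivatives. Hence the [fine] in [Mpop] is applied to a finite integral. *)
Lemma integrable_increment t s :
  Q.-integrable setT (EFin \o (fun x => h x t - h x s)).
Proof.
have iD u : Q.-integrable setT
    (fun x => (t - s)%:E * (EFin \o (fun x => Dplus (h x) u)) x)%E.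
  by apply: integrableZl => //; exact: integrable_Dplus.
have iB := integrableD measurableT (integrable_norm (iD t))
  (integrable_norm (iD s)).
apply: le_integrable iB => //.
  by apply/measurable_EFinP; exact: measurable_funB.
move=> x _; rewrite /= !lee_fin.
have := Dplus_subgradient _ _ t s (ch x).
have := Dplus_subgradient _ _ s t (ch x).
set A := Dplus _ _; set B := Dplus _ _ => HA HB.
rewrite [leRHS]ger0_norm ?addr_ge0 // ler_norml.
have := ler_norm ((t - s) * B); have := ler_norm (- ((t - s) * A)).
rewrite normrN.
have := normr_ge0 ((t - s) * B); have := normr_ge0 ((t - s) * A); nra.
Qed.

Lemma MpopB t0 t s : Mpop Q h t0 t - Mpop Q h t0 s = \int[Q]_x (h x t - h x s).
Proof.
rewrite -[Mpop _ _ _ _ - _]RintegralB //; try exact: integrable_increment.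
by apply: eq_Rintegral => x _; ring.
Qed.

Lemma Mpop_convex t0 : convex_fun (Mpop Q h t0).
Proof.
move=> x y l l0 l1.
have iI u : Q.-integrable setT (EFin \o (fun z => h z u - h z t0)).
  exact: integrable_increment.
have iZ k u : Q.-integrable setT (EFin \o (fun z => k * (h z u - h z t0))).
  exact: (integrableZl measurableT k (iI u)).
rewrite -[l * Mpop _ _ _ _]RintegralZl // -[(1 - l) * Mpop _ _ _ _]RintegralZl //.
rewrite -RintegralD //; apply: le_Rintegral => //.
  exact: (integrableD measurableT (iZ _ _) (iZ _ _)).
move=> z _; have := ch z x y l l0 l1; lra.
Qed.

(** Dominated convergence along the steps [harmonic n]. As these are at most 1, convexity places
    every quotient between [Dplus (h x) t] and [Dplus (h x) (t + 1)]. *)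
Lemma Dplus_Mpop t0 t : Dplus (Mpop Q h t0) t = \int[Q]_x Dplus (h x) t.
Proof.
pose f n x := (h x (t + harmonic n) - h x t) / harmonic n.
have h1 n : @harmonic R n <= 1 by rewrite /harmonic invf_le1 // ler1n.
have mf n : measurable_fun setT (EFin \o f n).
  by apply/measurable_EFinP/measurable_funM => //; exact: measurable_funB.
have iB : Q.-integrable setT (EFin \o (fun x =>
    `|Dplus (h x) t| + `|Dplus (h x) (t + 1)|)).
  exact: (integrableD measurableT (integrable_norm (integrable_Dplus t))
    (integrable_norm (integrable_Dplus (t + 1)))).
have fB n x : `|f n x| <= `|Dplus (h x) t| + `|Dplus (h x) (t + 1)|.
  have e0 := @harmonic_gt0 R n; have e1 := h1 n.
  have := Dplus_subgradient _ _ t (t + harmonic n) (ch x).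
  have := Dplus_subgradient _ _ (t + 1) t (ch x).
  have := ch x (t + 1) t _ (ltW e0) e1.
  rewrite /f; move: (harmonic n) e0 e1 => e e0 e1.
  have -> : e * (t + 1) + (1 - e) * t = t + e by ring.
  set A := Dplus _ _; set B := Dplus _ _ => conv subB subA.
  have lo : B <= (h x (t + e) - h x t) / e by rewrite ler_pdivlMr //; nra.
  have up : (h x (t + e) - h x t) / e <= A by rewrite ler_pdivrMr //; nra.
  have := ler_norm A; have := ler_norm (- B); rewrite normrN ler_norml.
  have := normr_ge0 A; have := normr_ge0 B; lra.
have fcvg : {ae Q, forall x, setT x ->
    (EFin \o f n) x @[n --> \oo] --> (Dplus (h x) t)%:E}.
  apply: aeW => x _; apply: cvg_EFin; first exact: nearW.
  exact: Dplus_harmonic_cvg.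
have mD : measurable_fun setT (EFin \o (fun x => Dplus (h x) t)).
  exact/measurable_EFinP/measurable_Dplus.
have [_ _ cv] := dominated_convergence measurableT mf mD fcvg iB
  (aeW Q (fun x n _ => fB n x)).
have := Dplus_harmonic_cvg _ _ t (Mpop_convex t0).
rewrite (_ : (fun n => _) = (fun n => \int[Q]_x f n x)); last first.
  apply/funext => n; rewrite MpopB -RintegralZr //.
  exact: integrable_increment.
move=> /cvg_unique; apply => //.
apply: fine_cvg; rewrite fineK //.
by apply: integrable_fin_num => //; exact: integrable_Dplus.
Qed.

End population.

(** * The maximal Hoeffding bound for identically distributed steps *)

Lemma measurable_exists_ge d (T : measurableType d) (A : nat -> set T) (n : nat) :
  (forall k, (n <= k)%N -> measurable (A k)) ->
  measurable [set w | exists k, (n <= k)%N /\ A k w].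
Proof.
move=> mA; rewrite (_ : [set w | _] = \bigcup_(k in [set k | (n <= k)%N]) A k).
  exact: bigcup_measurable.
by apply/seteqP; split => w [k]; [case|move=> nk Akw]; exists k.
Qed.

Section hoeffding_maximal.
Context {d d' : measure_display} {R : realType} {Omega : measurableType d}
  {S : measurableType d'} (P : probability Omega R) (Q : probability S R)
  (X : nat -> Omega -> S) (g : S -> R).
Hypothesis mX : forall i, measurable_fun setT (X i).
Hypothesis lawX : forall i (A : set S), measurable A -> P (X i @^-1` A) = Q A.
Hypothesis indX : mutually_independent P X.
Hypothesis mg : measurable_fun setT g.

Lemma ge0_integral_law i (f : S -> \bar R) : measurable_fun setT f ->
  (forall x, 0 <= f x)%E -> (\int[P]_w f (X i w) = \int[Q]_x f x)%E.
Proof.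
move=> mf f0.
pose Xi : {mfun Omega >-> S} :=
  HB.pack (X i) (isMeasurableFun.Build _ _ _ _ (X i) (mX i)).
transitivity (\int[distribution P Xi]_x f x)%E.
  by rewrite ge0_integral_distribution.
by apply: eq_measure_integral => A mA _; exact: lawX.
Qed.

Lemma integral_law i : Q.-integrable setT (EFin \o g) ->
  (\int[P]_w (g (X i w))%:E = \int[Q]_x (g x)%:E)%E.
Proof.
move=> /integrableP[mg' ig].
pose Xi : {mfun Omega >-> S} :=
  HB.pack (X i) (isMeasurableFun.Build _ _ _ _ (X i) (mX i)).
transitivity (\int[distribution P Xi]_x (g x)%:E)%E; last first.
  by apply: eq_measure_integral => A mA _; exact: lawX.
rewrite integral_distribution //; apply/integrableP; split.
  by apply: measurableT_comp => //; exact: mX.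
rewrite (ge0_integral_law i (fun x => `|(g x)%:E|)%E) //.
exact: measurableT_comp.
Qed.

Lemma measurable_walk_ge0 (n : nat) :
  measurable [set w | exists k, (n <= k)%N /\ (0 <= \sum_(i < k) g (X i w))%R].
Proof.
apply: measurable_exists_ge => k _.
rewrite (_ : (fun w => _) = (fun w => \sum_(i < k) g (X i w)) @^-1` `[0, +oo[).
  rewrite -[X in measurable X]setTI.
  have : measurable_fun setT (fun w => \sum_(i < k) g (X i w)).
    by apply: measurable_sum => i; exact: measurableT_comp.
  exact.
by apply/seteqP; split => w /=; rewrite in_itv/= andbT.
Qed.

Lemma hoeffding_maximal (a b : R) (n : nat) :
  Q.-integrable setT (EFin \o g) -> a < b ->
  {ae P, forall w, a <= g (X 0%N w) <= b} -> \int[Q]_x g x <= 0 ->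
  (P [set w | exists k, (n <= k)%N /\ (0 <= \sum_(i < k) g (X i w))%R] <=
   (expR (- 2 * (b - a) ^-2 * n%:R * (\int[Q]_x g x) ^+ 2))%:E)%E.
Proof.
move=> ig ab gab; set mu := Rintegral _ _ _ => mu0.
have ba0 : 0 < (b - a) ^+ 2 by rewrite exprn_gt0 // subr_gt0.
(* The minimizer of [l * mu + l ^+ 2 * (b - a) ^+ 2 / 8]. *)
pose l := - 4 * mu / (b - a) ^+ 2.
pose r := expR (- 2 * (b - a) ^- 2 * mu ^+ 2).
have l0 : 0 <= l by rewrite divr_ge0 ?(ltW ba0) //; lra.
have -> : expR (- 2 * (b - a) ^-2 * n%:R * mu ^+ 2) = r ^+ n.
  by rewrite /r -expRM_natl; congr expR; ring.
apply: (maximal_walk_le P X g mX indX mg l r l0).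
  rewrite -expR0 ler_expR mulr_le0_ge0 ?sqr_ge0 //.
  by rewrite mulr_le0_ge0 ?invr_ge0 ?(ltW ba0) // oppr_le0.
move=> i.
have mexp : measurable_fun setT (fun x => (expR (l * g x))%:E).
  by apply/measurable_EFinP/measurableT_comp => //; exact: measurable_funM.
have exp0 x : (0 <= (expR (l * g x))%:E)%E by rewrite lee_fin expR_ge0.
(* The almost sure bounds concern [X 0] only; equality of laws moves the exponential moment from
   [X i] to [X 0]. *)
rewrite (ge0_integral_law i (fun x => (expR (l * g x))%:E) mexp exp0).
rewrite -(ge0_integral_law 0 (fun x => (expR (l * g x))%:E) mexp exp0).
apply: (le_trans (@hoeffding_mgf_le _ _ _ P (fun w => g (X 0 w)) a b l _ ab l0 gab)).
  exact: measurableT_comp.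
rewrite integral_law // -/(Rintegral Q setT g) -/mu lee_fin ler_expR.
rewrite le_eqVlt; apply/orP; left; apply/eqP; rewrite /l; field.
by rewrite subr_eq0 gt_eqF.
Qed.

End hoeffding_maximal.

(** * Tail bounds for the smallest minimizer *)

Lemma Memp_subgradient (R : realType) dS (S : measurableType dS) (Omega : Type)
    (h : S -> R -> R) (t0 : R) (X : nat -> Omega -> S) (n : nat) (w : Omega)
    (t s : R) : (forall x, convex_fun (h x)) ->
  Memp h t0 X n w t +
    n%:R^-1 * (\sum_(i < n) Dplus (h (X i w)) t) * (s - t) <= Memp h t0 X n w s.
Proof.
move=> ch; rewrite /Memp -mulrA -mulrDr ler_wpM2l ?invr_ge0 ?ler0n //.
rewrite mulr_suml -big_split /=; apply: ler_sum => i _.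
by have := Dplus_subgradient _ _ t s (ch (X i w)); lra.
Qed.

Theorem theorem1 (R : realType) (dS dO : measure_display)
  (S : measurableType dS) (Q : probability S R) (h : S -> R -> R)
  (h_meas : forall t : R, measurable_fun setT (fun x => h x t))
  (h_conv : forall x : S, convex_fun (h x))
  (hDp_int : forall t : R, (\int[Q]_x (`|Dplus (h x) t|)%:E < +oo)%E)
  (hDm_int : forall t : R, (\int[Q]_x (`|Dminus (h x) t|)%:E < +oo)%E)
  (t0 : R)
  (Omega : measurableType dO) (P : probability Omega R)
  (X : nat -> Omega -> S)
  (X_meas : forall i, measurable_fun setT (X i))
  (X_law : forall i (A : set S), measurable A -> P (X i @^-1` A) = Q A)
  (X_indep : mutually_independent P X)
  (mhat : nat -> Omega -> R)
  (mhat_meas : forall n, (0 < n)%N -> measurable_fun setT (mhat n))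
  (mhat_min : forall n w, (0 < n)%N ->
     (forall t, Memp h t0 X n w (mhat n w) <= Memp h t0 X n w t) /\
     (forall s, (forall t, Memp h t0 X n w s <= Memp h t0 X n w t) ->
        mhat n w <= s))
  (m : R)
  (Hm : Dminus (Mpop Q h t0) m <= 0 <= Dplus (Mpop Q h t0) m)
  (a b : R -> R)
  (HB : forall x : R, x != 0 ->
     a x < b x /\
     {ae P, forall w, a x <= Dplus (h (X 0%N w)) (m + x) <= b x}) :
  let DM := Dplus (Mpop Q h t0) in
  let A := fun x => Num.max (b x - a x) (b (- x) - a (- x)) in
  let d := fun x => Num.min (DM (m + x)) (- DM (m - x)) in
  (forall (n : nat), (0 < n)%N -> forall x : R, 0 < x ->
     (P [set w | exists k, (n <= k)%N /\ (x < mhat k w - m)%R]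
      <= (expR (- 2 * (b x - a x) ^-2 * n%:R * DM (m + x) ^+ 2))%:E)%E) /\
  (forall (n : nat), (0 < n)%N -> forall x : R, 0 < x ->
     (P [set w | exists k, (n <= k)%N /\ (mhat k w - m < - x)%R]
      <= (expR (- 2 * (b (- x) - a (- x)) ^-2 * n%:R * DM (m - x) ^+ 2))%:E)%E) /\
  (forall (n : nat), (0 < n)%N -> forall x : R, 0 < x ->
     (P [set w | exists k, (n <= k)%N /\ (x < `|mhat k w - m|)%R]
      <= (2 * expR (- 2 * A x ^-2 * n%:R * d x ^+ 2))%:E)%E) /\
  (forall x : R, 0 < x -> 0 <= d x) /\
  ((forall t : R, (forall s, Mpop Q h t0 t <= Mpop Q h t0 s) -> t = m) ->
     forall x : R, 0 < x -> 0 < d x /\ 0 < DM (m + x) /\ 0 < - DM (m - x)).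
Proof.
move=> DM A d.
have cM := Mpop_convex Q h h_meas h_conv hDp_int t0.
have DME t : DM t = \int[Q]_x Dplus (h x) t by exact: Dplus_Mpop.
have /andP[Dm0 Dp0] := Hm.
(* Adding the subgradient inequalities at [m] and [m + x] gives [DM m <= DM (m + x)]; on the left,
   [Dminus] at [m] plays the same role. *)
have DMp x : 0 < x -> 0 <= DM (m + x).
  move=> x0.
  have := Dplus_subgradient _ _ m (m + x) cM.
  have := Dplus_subgradient _ _ (m + x) m cM.
  rewrite -/(DM _) -/(DM _) in Dp0 *; nra.
have DMn x : 0 < x -> DM (m - x) <= 0.
  move=> x0.
  have := Dminus_subgradient _ _ m (m - x) cM.
  have := Dplus_subgradient _ _ (m - x) m cM.
  rewrite -/(DM _); nra.
have mDp t i : measurable_fun setT (fun w => Dplus (h (X i w)) t).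
  apply: (@measurableT_comp _ _ _ _ _ _ (fun x => Dplus (h x) t)) => //.
  exact: measurable_Dplus.
(* Minimality of [mhat n w] makes the derivative sum at [t] times [mhat n w - t] nonpositive, which
   fixes the sign of the sum on each tail event. *)
have hat_sub n w t : (0 < n)%N ->
    Memp h t0 X n w t + n%:R^-1 * (\sum_(i < n) Dplus (h (X i w)) t) *
      (mhat n w - t) <= Memp h t0 X n w t.
  move=> n0; apply: le_trans (Memp_subgradient _ _ _ _ _ t0 X n w t _ h_conv) _.
  by have [+ _] := mhat_min n w n0; apply.
have mright n x : (0 < n)%N ->
    measurable [set w | exists k, (n <= k)%N /\ (x < mhat k w - m)%R].
  move=> n0; apply: measurable_exists_ge => k nk.
  rewrite (_ : (fun w => _) = mhat k @^-1` `]m + x, +oo[).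
    rewrite -[X in measurable X]setTI.
    by apply: mhat_meas => //; exact: leq_trans nk.
  by apply/seteqP; split => w /=; rewrite in_itv/= andbT ltrBrDl.
have mleft n x : (0 < n)%N ->
    measurable [set w | exists k, (n <= k)%N /\ (mhat k w - m < - x)%R].
  move=> n0; apply: measurable_exists_ge => k nk.
  rewrite (_ : (fun w => _) = mhat k @^-1` `]-oo, m - x[).
    rewrite -[X in measurable X]setTI.
    by apply: mhat_meas => //; exact: leq_trans nk.
  by apply/seteqP; split => w /=; rewrite in_itv/= ltrBlDl.
have right_tail n : (0 < n)%N -> forall x, 0 < x ->
    (P [set w | exists k, (n <= k)%N /\ (x < mhat k w - m)%R]
      <= (expR (- 2 * (b x - a x) ^-2 * n%:R * DM (m + x) ^+ 2))%:E)%E.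
  move=> n0 x x0.
  have [ab abD] := HB x (lt0r_neq0 x0).
  (* A minimizer beyond [m + x] forces a nonpositive derivative sum, so the sign is changed and the
     bounds become [- b x] and [- a x]. *)
  pose g y := - Dplus (h y) (m + x).
  have mg : measurable_fun setT g.
    by apply: measurableT_comp => //; exact: measurable_Dplus.
  have ig : Q.-integrable setT (EFin \o g).
    exact: (integrableN (integrable_Dplus Q h h_meas h_conv hDp_int (m + x))).
  have gE : \int[Q]_y g y = - DM (m + x).
    rewrite DME -[RHS]mulN1r -RintegralZl //.
      by apply: eq_Rintegral => y _; rewrite mulN1r.
    exact: integrable_Dplus.
  have := hoeffding_maximal P Q X g X_meas X_law X_indep mg (- b x) (- a x) n ig.
  rewrite gE sqrrN oppr_le0 opprK (addrC (- a x)) => /(_ _ _ (DMp x x0)) bound.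
  apply: le_trans (bound _ _); last 2 first.
  - by rewrite ltrN2.
  - by apply: filterS abD => w; rewrite /g !lerN2 andbC.
  apply: le_measure; rewrite ?inE.
  - exact: mright.
  - exact: measurable_walk_ge0.
  - move=> w [k [nk xk]]; exists k; split => //.
    have k0 : (0 < k)%N := leq_trans n0 nk.
    rewrite /g sumrN oppr_ge0 leNgt; apply/negP => D0.
    have := hat_sub k w (m + x) k0.
    rewrite gerDl leNgt => /negP; apply.
    by rewrite mulr_gt0 ?mulr_gt0 ?invr_gt0 ?ltr0n //; lra.
have left_tail n : (0 < n)%N -> forall x, 0 < x ->
    (P [set w | exists k, (n <= k)%N /\ (mhat k w - m < - x)%R]
      <= (expR (- 2 * (b (- x) - a (- x)) ^-2 * n%:R * DM (m - x) ^+ 2))%:E)%E.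
  move=> n0 x x0.
  have xn0 : - x != 0 by rewrite oppr_eq0 lt0r_neq0.
  have [ab abD] := HB (- x) xn0.
  pose g y := Dplus (h y) (m - x).
  have mg : measurable_fun setT g by exact: measurable_Dplus.
  have ig : Q.-integrable setT (EFin \o g) by exact: integrable_Dplus.
  have gE : \int[Q]_y g y = DM (m - x) by rewrite DME.
  have := hoeffding_maximal P Q X g X_meas X_law X_indep mg _ _ n ig ab abD.
  rewrite gE => /(_ (DMn x x0)); apply: le_trans.
  apply: le_measure; rewrite ?inE.
  - exact: mleft.
  - exact: measurable_walk_ge0.
  - move=> w [k [nk xk]]; exists k; split => //.
    have k0 : (0 < k)%N := leq_trans n0 nk.
    rewrite leNgt; apply/negP => D0.
    have := hat_sub k w (m - x) k0.
    rewrite gerDl leNgt => /negP; apply.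
    by rewrite nmulr_lgt0 ?pmulr_rlt0 ?invr_gt0 ?ltr0n //; lra.
have d0 x : 0 < x -> 0 <= d x.
  by move=> x0; rewrite /d le_min DMp //= oppr_ge0 DMn.
split; first exact: right_tail.
split; first exact: left_tail.
split; [|split=> //].
- move=> n n0 x x0.
  have xn0 : - x != 0 by rewrite oppr_eq0 lt0r_neq0.
  have [ab _] := HB x (lt0r_neq0 x0).
  have [abN _] := HB (- x) xn0.
  (* Enlarging the width to [A x] and shrinking the derivative to [d x] only raises the bound, so
     both tails get a common rate. *)
  have weaken (u D : R) : 0 < u -> u <= A x -> d x <= `|D| ->
      expR (- 2 * u ^- 2 * n%:R * D ^+ 2) <=
      expR (- 2 * A x ^-2 * n%:R * d x ^+ 2).
    move=> u0 uA dD.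
    have A0 : 0 < A x := lt_le_trans u0 uA.
    rewrite ler_expR !mulNr lerN2 ler_pM ?sqr_ge0 //.
    + by rewrite !mulr_ge0 ?invr_ge0 ?ler0n ?sqr_ge0.
    + rewrite ler_wpM2r ?ler0n // ler_wpM2l // lef_pV2 ?posrE ?exprn_gt0 //.
      by rewrite lerXn2r ?nnegrE ?(ltW u0) ?(ltW A0).
    + by rewrite -(real_normK (num_real D)) lerXn2r ?nnegrE ?d0.
  rewrite (_ : [set w | _] =
      [set w | exists k, (n <= k)%N /\ (x < mhat k w - m)%R] `|`
      [set w | exists k, (n <= k)%N /\ (mhat k w - m < - x)%R]); last first.
    apply/seteqP; split => w /=.
      by move=> [k [nk]]; rewrite ltr_normr ltrNr => /orP[]; [left|right]; exists k.
    by move=> [] [k [nk kx]]; exists k; split => //; rewrite ltr_normr (ltrNr x) kx ?orbT.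
  apply: le_trans (measureU2 _ (mright _ _ n0) (mleft _ _ n0)) _.
  rewrite mulr_natl mulr2n EFinD; apply: leeD.
    apply: le_trans (right_tail n n0 x x0) _; rewrite lee_fin weaken //.
    + by rewrite subr_gt0.
    + by rewrite /A le_max lexx.
    + by rewrite ger0_norm ?DMp // /d ge_min lexx.
  apply: le_trans (left_tail n n0 x x0) _; rewrite lee_fin weaken //.
  + by rewrite subr_gt0.
  + by rewrite /A le_max lexx orbT.
  + by rewrite ler0_norm ?DMn // /d ge_min lexx orbT.
- move=> uniq_m x x0.
  have minM t : Mpop Q h t0 m <= Mpop Q h t0 t.
    have := Dplus_subgradient _ _ m t cM; have := Dminus_subgradient _ _ m t cM.
    by have [] := leP m t; nra.
  (* A zero derivative at [m + x] is a zero subgradient and would make [m + x] a second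
     minimizer. *)
  have DMp' : 0 < DM (m + x).
    rewrite lt0r DMp // andbT; apply/eqP => D0.
    suff : m + x = m by lra.
    apply: uniq_m => s; have := minM s; apply: le_trans.
    have := Dplus_subgradient _ _ (m + x) m cM.
    by rewrite -/(DM _) D0 mul0r addr0.
  have DMn' : 0 < - DM (m - x).
    rewrite lt0r oppr_ge0 DMn // andbT oppr_eq0; apply/eqP => D0.
    suff : m - x = m by lra.
    apply: uniq_m => s; have := minM s; apply: le_trans.
    have := Dplus_subgradient _ _ (m - x) m cM.
    by rewrite -/(DM _) D0 mul0r addr0.
  by rewrite /d lt_min DMp' DMn'.
Qed.
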